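(* Let $\mathcal{T}$ be a triangulated category with a semiorthogonal decomposition $\mathcal{T}=\langle \mathcal{T}_1,\mathcal{T}_2\rangle$. Let $\mathcal{T}_1^{\le 0}$ and $\mathcal{T}_2^{\le 0}$ be t-structures on $\mathcal{T}_1$ and $\mathcal{T}_2$ respectively which are compatible in $\mathcal{T}$. Then the full subcategory $$\mathcal{T}^{\le 0}:=\mathcal{T}_2^{\le 0} * (\mathcal{T}_1^{\le 0}[1])$$ is a t-structure on $\mathcal{T}$. Furthermore: 1. If $\mathcal{T}_1^{\le 0}$ and $\mathcal{T}_2^{\le 0}$ are bounded (respectively non-degenerate), then $\mathcal{T}^{\le 0}$ is bounded (respectively non-degenerate). 2. Let $\mathcal{A}_1$, $\mathcal{A}_2$ and $\mathcal{A}$ be the hearts associated to $\mathcal{T}_1^{\le 0}$, $\mathcal{T}_2^{\le 0}$ and $\mathcal{T}^{\le 0}$ respectively. Then $\mathcal{A}=\mathcal{A}_2 * (\mathcal{A}_1[1])$. 3. Whenever at least one of the two hearts $\mathcal{A}_1,\mathcal{A}_2$ is nonzero, $$\dim_{\mathcal{T}}\mathcal{A}=\max\{\dim_{\mathcal{T}_1}\mathcal{A}_1,\ \dim_{\mathcal{T}_2}\mathcal{A}_2,\ \operatorname{rdim}_{\mathcal{T}}(\mathcal{A}_1,\mathcal{A}_2)+1\}.$$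
   Context: Semiorthogonal decomposition: $\mathcal{T}=\langle\mathcal{T}_1,\mathcal{T}_2\rangle$ means that $\mathcal{T}_1,\mathcal{T}_2$ are full triangulated subcategories of $\mathcal{T}$ with $\operatorname{Hom}(\mathcal{T}_2,\mathcal{T}_1)=0$, and for every $E\in\mathcal{T}$ there is a distinguished triangle $E_2\to E\to E_1\to E_2[1]$ with $E_2\in\mathcal{T}_2$ and $E_1\in\mathcal{T}_1$. Operation $*$: for full subcategories $\mathcal{X},\mathcal{Y}\subset\mathcal{T}$, $\mathcal{X}*\mathcal{Y}$ is the full subcategory of objects $Z$ for which there is a distinguished triangle $X\to Z\to Y\to X[1]$ with $X\in\mathcal{X}$, $Y\in\mathcal{Y}$. t-structure: a t-structure on a triangulated category $\mathcal{D}$ is a full subcategory $\mathcal{D}^{\le 0}$ with $\mathcal{D}^{\le 0}[1]\subset\mathcal{D}^{\le 0}$ such that every $E\in\mathcal{D}$ fits in a distinguished triangle $A\to E\to B\to A[1]$ with $A\in\mathcal{D}^{\le 0}$ and $B\in\mathcal{D}^{\ge 1}:=(\mathcal{D}^{\le 0})^{\bot}$, where $\mathcal{C}^{\bot}$ is the full subcategory of those $Y \in \mathcal{D}$ with $\operatorname{Hom}(X,Y)=0$ for all $X\in\mathcal{C}$ (the orthogonal is taken inside $\mathcal{D}$; so $\mathcal{T}_i^{\ge 1}$ is computed inside $\mathcal{T}_i$). Put $\mathcal{D}^{\le i}:=\mathcal{D}^{\le 0}[-i]$ and $\mathcal{D}^{\ge j}:=\mathcal{D}^{\ge 1}[-j+1]$.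 The t-structure is bounded if $\mathcal{D}=\bigcup_{i,j\in\mathbb{Z}}(\mathcal{D}^{\le i}\cap\mathcal{D}^{\ge j})$, and non-degenerate if $\bigcap_i\mathcal{D}^{\le i}=\bigcap_j\mathcal{D}^{\ge j}=0$. Its heart is $\mathcal{D}^{\ge 0}\cap\mathcal{D}^{\le 0}$. Compatibility: $\mathcal{T}_1^{\le 0}$ and $\mathcal{T}_2^{\le 0}$ are compatible in $\mathcal{T}$ if $\operatorname{Hom}(\mathcal{T}_1^{\le 0},\mathcal{T}_2^{\ge 1})=0$. Dimensions: for a heart $\mathcal{A}$ in $\mathcal{D}$, $\dim_{\mathcal{D}}\mathcal{A}$ is the greatest integer $n$ such that $\operatorname{Hom}(A,B[n])\neq 0$ for some $A,B\in\mathcal{A}$ (it is $+\infty$ if such $n$ are unbounded above; for a zero heart it is $-\infty$). The relative dimension $\operatorname{rdim}_{\mathcal{T}}(\mathcal{A}_1,\mathcal{A}_2)$ is $\sup\{m\in\mathbb{Z}\mid \operatorname{Hom}(A_1,A_2[m])\neq 0 \text{ for some } A_1\in\mathcal{A}_1, A_2\in\mathcal{A}_2\}$ if this set is nonempty, and $-1$ otherwise. *)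

(* Defs.v *)
From mathcomp Require Import all_boot all_order all_algebra.
From mathcomp Require Import boolp classical_sets constructive_ereal.

Set Implicit Arguments.
Unset Strict Implicit.
Unset Printing Implicit Defensive.

Import Order.TTheory GRing.Theory Num.Theory.
Local Open Scope ring_scope.
Local Open Scope classical_set_scope.

(* Composition is written in the usual order: [comp g f] is "g after f". *)
Record preadditiveCat := PreadditiveCat {
  obj :> Type;
  hom : obj -> obj -> zmodType;
  idm : forall X, hom X X;
  comp : forall X Y Z, hom Y Z -> hom X Y -> hom X Z;
  comp1m : forall X Y (f : hom X Y), comp (idm Y) f = f;
  compm1 : forall X Y (f : hom X Y), comp f (idm X) = f;
  compA : forall W X Y Z (h : hom Y Z) (g : hom X Y) (f : hom W X),
    comp h (comp g f) = comp (comp h g) f;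
  compDl : forall X Y Z (g g' : hom Y Z) (f : hom X Y),
    comp (g + g') f = comp g f + comp g' f;
  compDr : forall X Y Z (g : hom Y Z) (f f' : hom X Y),
    comp g (f + f') = comp g f + comp g f'
}.

Arguments hom {_} X Y.
Arguments idm {_} X.
Arguments comp {_ X Y Z} g f.

Notation "g \oc f" := (comp g f) (at level 40, left associativity).

Section Preadditive.
Context {T : preadditiveCat}.
Implicit Types X Y Z : T.

Definition is_iso X Y (f : hom X Y) :=
  exists g : hom Y X, g \oc f = idm X /\ f \oc g = idm Y.

Definition isomorphic X Y := exists f : hom X Y, is_iso f.

(* Initial and terminal; each hom group already contains 0. *)
Definition is_zero X :=
  forall Y, (forall f : hom X Y, f = 0) /\ (forall f : hom Y X, f = 0).

Definition is_biproduct X Y Z :=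
  exists (i : hom X Z) (j : hom Y Z) (p : hom Z X) (q : hom Z Y),
    [/\ p \oc i = idm X, q \oc j = idm Y, q \oc i = 0, p \oc j = 0
      & i \oc p + j \oc q = idm Z].

End Preadditive.

Record additiveCat := AdditiveCat {
  additive_base :> preadditiveCat;
  zobj : additive_base;
  zobjP : is_zero zobj;
  biproductP : forall X Y : additive_base, exists Z, is_biproduct X Y Z
}.

(* The shift [shift, shiftm] is only required to be an additive
   autoequivalence: it is fully faithful, and [unshift X] is a chosen object
   X[-1] with X[-1][1] isomorphic to X.
   [dist f g h] : the triangle X -f-> Y -g-> Z -h-> X[1] is distinguished.
   The last axioms are Verdier's TR1 - TR4. *)
Record triangulatedCat := TriangulatedCat {
  triangulated_base :> additiveCat;
  shift : triangulated_base -> triangulated_base;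
  shiftm : forall X Y : triangulated_base,
    hom X Y -> hom (shift X) (shift Y);
  shiftm1 : forall X, shiftm (idm X) = idm (shift X);
  shiftmM : forall X Y Z (g : hom Y Z) (f : hom X Y),
    shiftm (g \oc f) = shiftm g \oc shiftm f;
  shiftmD : forall X Y (f g : hom X Y), shiftm (f + g) = shiftm f + shiftm g;
  shiftm_bij : forall X Y, bijective (@shiftm X Y);
  unshift : triangulated_base -> triangulated_base;
  unshiftK : forall X, isomorphic (shift (unshift X)) X;
  dist : forall X Y Z : triangulated_base,
    hom X Y -> hom Y Z -> hom Z (shift X) -> Prop;
  TR1_id : forall X, dist (idm X) (0 : hom X (zobj _)) 0;
  TR1_iso : forall X Y Z X' Y' Z'
      (f : hom X Y) (g : hom Y Z) (h : hom Z (shift X))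
      (f' : hom X' Y') (g' : hom Y' Z') (h' : hom Z' (shift X'))
      (a : hom X X') (b : hom Y Y') (c : hom Z Z'),
    is_iso a -> is_iso b -> is_iso c ->
    b \oc f = f' \oc a -> c \oc g = g' \oc b -> shiftm a \oc h = h' \oc c ->
    dist f g h -> dist f' g' h';
  TR1_cone : forall X Y (f : hom X Y),
    exists Z (g : hom Y Z) (h : hom Z (shift X)), dist f g h;
  TR2 : forall X Y Z (f : hom X Y) (g : hom Y Z) (h : hom Z (shift X)),
    dist f g h <-> dist g h (- shiftm f);
  TR3 : forall X Y Z X' Y' Z'
      (f : hom X Y) (g : hom Y Z) (h : hom Z (shift X))
      (f' : hom X' Y') (g' : hom Y' Z') (h' : hom Z' (shift X'))
      (a : hom X X') (b : hom Y Y'),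
    dist f g h -> dist f' g' h' -> b \oc f = f' \oc a ->
    exists2 c : hom Z Z', c \oc g = g' \oc b & shiftm a \oc h = h' \oc c;
  TR4 : forall X Y Z X' Y' Z' (f : hom X Y) (g : hom Y Z)
      (f1 : hom Y Z') (f2 : hom Z' (shift X))
      (g1 : hom Z X') (g2 : hom X' (shift Y))
      (h1 : hom Z Y') (h2 : hom Y' (shift X)),
    dist f f1 f2 -> dist g g1 g2 -> dist (g \oc f) h1 h2 ->
    exists (u : hom Z' Y') (v : hom Y' X'),
      [/\ dist u v (shiftm f1 \oc g2),
          u \oc f1 = h1 \oc g, h2 \oc u = f2,
          v \oc h1 = g1 & g2 \oc v = shiftm f \oc h2]
}.

Arguments shift {_} X.
Arguments shiftm {_ X Y} f.
Arguments unshift {_} X.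
Arguments dist {_ X Y Z} f g h.

(* A full subcategory is given by its class of objects [C : set T].  As usual
   in this context, subcategories are strictly full (closed under
   isomorphism): this is part of [triangulated_subcat] and [t_structure], and
   [shift_subcat] is the essential image. *)
Section Triangulated.
Context {T : triangulatedCat}.
Implicit Types (X Y Z E : T) (C D : set T).

(* X[n] *)
Definition shiftz X (n : int) : T :=
  match n with
  | Posz k => iter k shift X
  | Negz k => iter k.+1 unshift X
  end.

Definition strictly_full C := forall X Y, isomorphic X Y -> C X -> C Y.

Definition zero_subcat : set T := [set X | is_zero X].

(* C[n] *)
Definition shift_subcat C (n : int) : set T :=
  [set Z | exists2 X, C X & isomorphic Z (shiftz X n)].

(* Hom(C, D) = 0 *)
Definition hom_vanish C D :=
  forall X Y, C X -> D Y -> forall f : hom X Y, f = 0.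

(* C * D *)
Definition star C D : set T :=
  [set Z | exists X Y (f : hom X Z) (g : hom Z Y) (h : hom Y (shift X)),
     [/\ C X, D Y & dist f g h]].

Definition triangulated_subcat D :=
  [/\ strictly_full D,
      zero_subcat `<=` D,
      (forall X, D X -> D (shift X)),
      (forall X, D X -> D (unshift X))
    & forall X Y Z (f : hom X Y) (g : hom Y Z) (h : hom Z (shift X)),
        dist f g h -> D X -> D Y -> D Z].

(* T = <T1, T2> *)
Definition semiorthogonal_decomposition (T1 T2 : set T) :=
  [/\ triangulated_subcat T1, triangulated_subcat T2,
      hom_vanish T2 T1 & star T2 T1 = setT].

(* In what follows D is a full triangulated subcategory, regarded as a
   triangulated category in its own right: its homs, its shift and its
   distinguished triangles are those of T. *)

(* The right orthogonal of C, taken inside D. *)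
Definition right_orth D C : set T :=
  [set Y | D Y /\ forall X, C X -> forall f : hom X Y, f = 0].

(* [C], playing the role of D^{<= 0}, is a t-structure on D. *)
Definition t_structure D C :=
  [/\ C `<=` D, strictly_full C, shift_subcat C 1 `<=` C
    & forall E, D E ->
        exists A B (f : hom A E) (g : hom E B) (h : hom B (shift A)),
          [/\ C A, right_orth D C B & dist f g h]].

(* D^{<= i} and D^{>= j} *)
Definition tle C (i : int) : set T := shift_subcat C (- i).
Definition tge D C (j : int) : set T :=
  shift_subcat (right_orth D C) (- j + 1).

Definition heart D C : set T := tge D C 0 `&` tle C 0.

Definition t_bounded D C :=
  D = \bigcup_(i : int) \bigcup_(j : int) (tle C i `&` tge D C j).

Definition t_nondegenerate D C :=
  \bigcap_(i : int) tle C i = zero_subcat /\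
  \bigcap_(j : int) tge D C j = zero_subcat.

(* Compatibility in T of t-structures C1 on T1 and C2 on T2; [right_orth T2 C2]
   is T2^{>= 1}. *)
Definition t_compatible (C1 T2 C2 : set T) :=
  hom_vanish C1 (right_orth T2 C2).

Definition hom_degrees C D : set int :=
  [set n | exists X Y (f : hom X (shiftz Y n)), [/\ C X, D Y & f <> 0]].

(* [supremum x0 S] is the least upper bound of S, and x0 if S is empty.
   Since D is full in T, the dimension of a heart A in D does not mention D. *)
Definition dim_heart (A : set T) : \bar int :=
  supremum -oo%E (EFin @` hom_degrees A A).

Definition rdim (A1 A2 : set T) : \bar int :=
  supremum (-1)%:E (EFin @` hom_degrees A1 A2).

End Triangulated.

(* Main.v *)
(** Write P_i for T_i^{<= 0} and N_i for T_i^{>= 1}.  The operation * is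
    associative by the octahedral axiom, so
      T = T_2 * T_1 = P_2 * (N_2 * P_1[1]) * N_1[1].
    Compatibility says that Hom(P_1[1], N_2[1]) = 0, hence a triangle exhibiting
    an object of N_2 * P_1[1] splits and the two factors can be exchanged:
      T = (P_2 * P_1[1]) * (N_2 * N_1[1]).
    All Homs from the first factor to the second vanish, which forces
    T^{>= 1} = N_2 * N_1[1].  Uniqueness of the triangle E_2 -> E -> E_1 of the
    semiorthogonal decomposition makes intersections of such classes computable
    factor by factor; this gives non-degeneracy and the heart.  Finally, for
    A = A_2 * A_1[1] the degrees n with Hom(A, A[n]) <> 0 are those of A_1,
    those of A_2, and m + 1 for the m with Hom(A_1, A_2[m]) <> 0. *)

From mathcomp Require Import all_boot all_order all_algebra.
From mathcomp Require Import boolp classical_sets constructive_ereal.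
Require Import Defs.

Set Implicit Arguments.
Unset Strict Implicit.
Unset Printing Implicit Defensive.

Import Order.TTheory GRing.Theory Num.Theory.
Local Open Scope ring_scope.
Local Open Scope classical_set_scope.

(** * Zero maps, isomorphisms and zero objects in a preadditive category *)

Section PreadditiveTheory.
Context {T : preadditiveCat}.
Implicit Types X Y Z W : T.

Definition hom0 X Y := forall f : hom X Y, f = 0.

Lemma comp0m X Y Z (f : hom X Y) : (0 : hom Y Z) \oc f = 0.
Proof. by apply: (addrI ((0 : hom Y Z) \oc f)); rewrite -compDl !addr0. Qed.

Lemma compm0 X Y Z (g : hom Y Z) : g \oc (0 : hom X Y) = 0.
Proof. by apply: (addrI (g \oc (0 : hom X Y))); rewrite -compDr !addr0. Qed.

Lemma compNm X Y Z (g : hom Y Z) (f : hom X Y) : (- g) \oc f = - (g \oc f).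
Proof. by apply/eqP; rewrite -addr_eq0 -compDl addNr comp0m. Qed.

Lemma compmN X Y Z (g : hom Y Z) (f : hom X Y) : g \oc (- f) = - (g \oc f).
Proof. by apply/eqP; rewrite -addr_eq0 -compDr addNr compm0. Qed.

Lemma is_iso_idm X : is_iso (idm X).
Proof. by exists (idm X); rewrite comp1m. Qed.

Lemma is_isoP X Y (f : hom X Y) (l r : hom Y X) :
  l \oc f = idm X -> f \oc r = idm Y -> is_iso f.
Proof.
move=> lf fr; exists r; split=> //.
by rewrite -[r]comp1m -lf -[l \oc f \oc r]compA fr compm1.
Qed.

Lemma isomorphic_refl X : isomorphic X X.
Proof. by exists (idm X); exact: is_iso_idm. Qed.

Lemma isomorphic_sym X Y : isomorphic X Y -> isomorphic Y X.
Proof. by case=> f [g [gf fg]]; exists g, f. Qed.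

Lemma isomorphic_trans Y X Z :
  isomorphic X Y -> isomorphic Y Z -> isomorphic X Z.
Proof.
case=> f [f' [f'f ff']] [g [g' [g'g gg']]].
exists (g \oc f), (f' \oc g'); split.
  by rewrite compA -(compA f') g'g compm1.
by rewrite compA -(compA g) ff' compm1.
Qed.

Lemma hom0_iso X X' Y Y' :
  isomorphic X X' -> isomorphic Y Y' -> hom0 X Y -> hom0 X' Y'.
Proof.
case=> a [a' [_ aa']] [b [b' [_ bb']]] XY0 f.
rewrite -[f]comp1m -[f]compm1 -aa' -bb' (compA f) -(compA b).
by rewrite (compA b') (XY0 (b' \oc (f \oc a))) comp0m compm0.
Qed.

Lemma is_zeroP X : is_zero X <-> hom0 X X.
Proof.
split=> [/(_ X)[]//|X0 Y].
have id0 := X0 (idm X).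
split=> f; first by rewrite -[f]compm1 id0 compm0.
by rewrite -[f]comp1m id0 comp0m.
Qed.

Lemma is_zero_iso X Y : isomorphic X Y -> is_zero X -> is_zero Y.
Proof. by move=> XY /is_zeroP X0; apply/is_zeroP; exact: hom0_iso X0. Qed.

Lemma isomorphic_zero X Y : is_zero X -> is_zero Y -> isomorphic X Y.
Proof.
move=> X0 Y0; exists 0, 0.
by split; [rewrite ((X0 X).1 (idm X)) comp0m|rewrite ((Y0 Y).1 (idm Y)) comp0m].
Qed.

End PreadditiveTheory.

(** * The shift functor and its integer iterates *)

Section TriangulatedTheory.
Context {T : triangulatedCat}.
Implicit Types (X Y Z W : T) (C D : set T) (n : int).

Lemma shiftm0 X Y : shiftm (0 : hom X Y) = 0.
Proof. by apply: (addrI (shiftm (0 : hom X Y))); rewrite -shiftmD !addr0. Qed.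

Lemma shiftm_inj X Y : injective (@shiftm T X Y).
Proof. exact/bij_inj/shiftm_bij. Qed.

Lemma shiftm_surj X Y (f : hom (shift X) (shift Y)) :
  exists f0 : hom X Y, f = shiftm f0.
Proof. by case: (@shiftm_bij T X Y) => s' _ sK; exists (s' f); rewrite sK. Qed.

Lemma isomorphic_shift X Y : isomorphic (shift X) (shift Y) <-> isomorphic X Y.
Proof.
split=> -[f [g [gf fg]]].
  have [f0 ff0] := shiftm_surj f; have [g0 gg0] := shiftm_surj g.
  exists f0, g0; split; apply: shiftm_inj;
  by rewrite shiftmM -ff0 -gg0 shiftm1.
by exists (shiftm f), (shiftm g); split; rewrite -shiftmM ?gf ?fg shiftm1.
Qed.

Lemma hom0_shift X Y : hom0 (shift X) (shift Y) <-> hom0 X Y.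
Proof.
split=> XY0 f; first by apply: shiftm_inj; rewrite (XY0 (shiftm f)) shiftm0.
by have [f0 ->] := shiftm_surj f; rewrite (XY0 f0) shiftm0.
Qed.

Lemma is_zero_shift X : is_zero (shift X) <-> is_zero X.
Proof. by split=> /is_zeroP/hom0_shift/is_zeroP. Qed.

(** Positive and negative shifts are built from different functions, [shift] and [unshift]. A step
    that is an equivalence can be climbed and descended, so one argument reaches both signs. *)
Lemma int_iff_ind (P : int -> Prop) :
  P 0 -> (forall n, P n <-> P (n + 1)) -> forall n, P n.
Proof.
move=> P0 PS; elim/int_ind=> [//|n /PS|n Pn]; first by rewrite -addn1 PoszD.
by apply/PS; rewrite -addn1 PoszD opprD -addrA addNr addr0.
Qed.

Lemma shiftzS X n : isomorphic (shiftz X (n + 1)) (shift (shiftz X n)).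
Proof.
case: n => n; first by rewrite -PoszD addn1; exact: isomorphic_refl.
apply: isomorphic_sym.
case: n => [|n]; first exact: unshiftK.
have -> : Negz n.+1 + 1 = Negz n.
  by rewrite !NegzE -addn1 PoszD opprD -addrA addNr addr0.
exact: unshiftK.
Qed.

Lemma shiftz_iso X Y n : isomorphic X Y -> isomorphic (shiftz X n) (shiftz Y n).
Proof.
move=> XY; elim/int_iff_ind: n => // n.
have nX := shiftzS X n; have nY := shiftzS Y n.
split=> [/isomorphic_shift|] XYn.
  exact: isomorphic_trans nX (isomorphic_trans XYn (isomorphic_sym nY)).
apply/isomorphic_shift.
exact: isomorphic_trans (isomorphic_sym nX) (isomorphic_trans XYn nY).
Qed.

Lemma shiftzD X m n : isomorphic (shiftz (shiftz X m) n) (shiftz X (m + n)).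
Proof.
elim/int_iff_ind: n => [|n]; first by rewrite addr0; exact: isomorphic_refl.
have n1 := shiftzS (shiftz X m) n; have n2 := shiftzS X (m + n).
rewrite addrA; split=> [/isomorphic_shift|] XYn.
  exact: isomorphic_trans n1 (isomorphic_trans XYn (isomorphic_sym n2)).
apply/isomorphic_shift.
exact: isomorphic_trans (isomorphic_sym n1) (isomorphic_trans XYn n2).
Qed.

Lemma hom0_shiftz X Y n : hom0 (shiftz X n) (shiftz Y n) <-> hom0 X Y.
Proof.
elim/int_iff_ind: n => [//|n].
suff -> : hom0 (shiftz X (n + 1)) (shiftz Y (n + 1)) <->
          hom0 (shiftz X n) (shiftz Y n) by [].
have nX := shiftzS X n; have nY := shiftzS Y n.
split=> [XY0|/hom0_shift XY0].
  by apply/hom0_shift; exact: hom0_iso nX nY XY0.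
exact: hom0_iso (isomorphic_sym nX) (isomorphic_sym nY) XY0.
Qed.

(** * Exactness of Hom on distinguished triangles *)

Lemma dist_lift X Y Z W (f : hom X Y) (g : hom Y Z) (h : hom Z (shift X))
    (t : hom W Y) :
  dist f g h -> g \oc t = 0 -> exists s : hom W X, t = f \oc s.
Proof.
(* TR3 is applied from the rotated triangle W -> 0 -> W[1] to the rotation of the given one. The map
   it yields is the shift of the lift, as both rotations carry the same sign. *)
move=> /TR2 fgh gt0; have /TR2 W0 := TR1_id W.
have [|c _] := TR3 (a := t) (b := 0) W0 fgh; first by rewrite gt0 comp0m.
have [s ->] := shiftm_surj c.
rewrite shiftm1 compmN compm1 compNm -shiftmM => /oppr_inj/shiftm_inj ->.
by exists s.
Qed.

Lemma dist_colift X Y Z W (f : hom X Y) (g : hom Y Z) (h : hom Z (shift X))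
    (t : hom Y W) :
  dist f g h -> t \oc f = 0 -> exists s : hom Z W, t = s \oc g.
Proof.
move=> fgh tf0.
have W0 : dist (0 : hom (zobj T) W) (idm W) 0.
  (* Rotation asks for W -> W -> 0[1], while TR1 gives W -> W -> 0; the two third vertices are
     isomorphic zero objects. *)
  apply/TR2; have z0 := @zobjP T; have sz0 := (is_zero_shift (zobj T)).2 z0.
  have [c c_iso] := isomorphic_zero z0 sz0.
  apply: (TR1_iso (is_iso_idm _) (is_iso_idm _) c_iso) (TR1_id W) => //.
    by rewrite compm0 comp0m.
  by rewrite shiftm0 oppr0 compm0 comp0m.
have [|c cg _] := TR3 (a := 0) (b := t) fgh W0; first by rewrite tf0 comp0m.
by exists c; rewrite cg comp1m.
Qed.

(** In the exact sequence of Hom(W[1], -), the kernel of composition with f[1] is the image of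
    Hom(W[1], Z) = 0, and the shift is faithful. *)
Lemma dist_lift_shift X Y Z W (f : hom X Y) (g : hom Y Z) (h : hom Z (shift X))
    (s : hom W X) :
  dist f g h -> hom0 (shift W) Z -> f \oc s = 0 -> s = 0.
Proof.
move=> /TR2/TR2 fgh WZ0 fs0.
have [|t st] := dist_lift (t := shiftm s) fgh.
  by rewrite compNm -shiftmM fs0 shiftm0 oppr0.
by apply: shiftm_inj; rewrite st (WZ0 t) compm0 shiftm0.
Qed.

(** * Triangles recorded by their vertices only, up to isomorphism *)

Definition tri X Y Z :=
  exists (f : hom X Y) (g : hom Y Z) (h : hom Z (shift X)), dist f g h.

Lemma tri_iso X Y Z X' Y' Z' : isomorphic X X' -> isomorphic Y Y' ->
  isomorphic Z Z' -> tri X Y Z -> tri X' Y' Z'.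
Proof.
case=> a [a' [a'a aa']] [b [b' [b'b bb']]] [c [c' [c'c cc']]] [f [g [h fgh]]].
exists (b \oc f \oc a'), (c \oc g \oc b'), (shiftm a \oc h \oc c').
apply: (TR1_iso (a := a) (b := b) (c := c)) fgh.
- by exists a'.
- by exists b'.
- by exists c'.
- by rewrite -compA a'a compm1.
- by rewrite -compA b'b compm1.
- by rewrite -compA c'c compm1.
Qed.

Lemma tri_rot X Y Z : tri X Y Z <-> tri Y Z (shift X).
Proof.
split=> -[f [g [h]]]; first by move/TR2; exists g, h, (- shiftm f).
have [f' hE] := shiftm_surj (- h).
by rewrite -[h]opprK hE => /(TR2 f' f g).2; exists f', f, g.
Qed.

Lemma tri_shift X Y Z : tri (shift X) (shift Y) (shift Z) <-> tri X Y Z.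
Proof. by rewrite -!tri_rot. Qed.

Lemma tri_shiftz X Y Z n :
  tri (shiftz X n) (shiftz Y n) (shiftz Z n) <-> tri X Y Z.
Proof.
elim/int_iff_ind: n => [//|n]; rewrite -[in X in X <-> _]tri_shift.
have nX := shiftzS X n; have nY := shiftzS Y n; have nZ := shiftzS Z n.
suff -> : tri (shift (shiftz X n)) (shift (shiftz Y n)) (shift (shiftz Z n)) <->
          tri (shiftz X (n + 1)) (shiftz Y (n + 1)) (shiftz Z (n + 1)) by [].
split; first by apply: tri_iso; exact: isomorphic_sym.
exact: tri_iso.
Qed.

Lemma tri_octahedron X Y Z U V : tri X Y U -> tri Y Z V ->
  exists W, tri X Z W /\ tri U W V.
Proof.
case=> f [f1 [f2 fd]] [g [g1 [g2 gd]]].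
have [W [h1 [h2 hd]]] := TR1_cone (g \oc f).
have [u [v [uv _ _ _ _]]] := TR4 fd gd hd.
by exists W; split; [exists (g \oc f), h1, h2|exists u, v, (shiftm f1 \oc g2)].
Qed.

(** As X and X[1] are zero, the identity of Y extends along g and the identity of Z lifts through g,
    giving a left and a right inverse of g. *)
Lemma dist_iso_zerol X Y Z (f : hom X Y) (g : hom Y Z) (h : hom Z (shift X)) :
  dist f g h -> is_zero X -> is_iso g.
Proof.
move=> fgh X0.
have [|l lg] := dist_colift (t := idm Y) fgh.
  by rewrite ((X0 Y).1 f) compm0.
have [|r hr] := dist_lift (t := idm Z) ((TR2 f g h).1 fgh).
  by rewrite compm1; exact: ((is_zero_shift X).2 X0 Z).2.
exact: is_isoP (esym lg) (esym hr).
Qed.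

Lemma tri_zerol X Y Z : tri X Y Z -> is_zero X -> isomorphic Y Z.
Proof. by case=> f [g [h fgh]] X0; exists g; exact: dist_iso_zerol fgh X0. Qed.

Lemma zeror_tri X Z : is_zero Z -> tri X X Z.
Proof.
move=> Z0; have X0 : tri X X (zobj T) by exists (idm X), 0, 0; exact: TR1_id.
apply: tri_iso X0; [exact: isomorphic_refl|exact: isomorphic_refl|].
exact: isomorphic_zero (@zobjP T) Z0.
Qed.

Lemma zerol_tri X Z : is_zero X -> tri X Z Z.
Proof. by move=> X0; apply/tri_rot/zeror_tri/is_zero_shift. Qed.

Lemma tri_hom0_from X Y Z W : tri X Y Z -> hom0 X W -> hom0 Z W -> hom0 Y W.
Proof.
case=> f [g [h fgh]] XW0 ZW0 t.
have [|s ->] := dist_colift (t := t) fgh; first exact: XW0.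
by rewrite (ZW0 s) comp0m.
Qed.

Lemma tri_hom0_to X Y Z W : tri X Y Z -> hom0 W X -> hom0 W Z -> hom0 W Y.
Proof.
case=> f [g [h fgh]] WX0 WZ0 t.
have [|s ->] := dist_lift (t := t) fgh; first exact: WZ0.
by rewrite (WX0 s) compm0.
Qed.

(** The connecting map Z -> X[1] vanishes, so g has a section s. A cone of s is isomorphic to X, and
    the triangle on s has the outer terms exchanged. *)
Lemma tri_swap X Y Z : hom0 Z (shift X) -> tri X Y Z -> tri Z Y X.
Proof.
move=> ZX0 [f [g [h fgh]]].
have [|s gs] := dist_lift (t := idm Z) ((TR2 f g h).1 fgh).
  by rewrite compm1; exact: ZX0.
have [W [s1 [s2 sd]]] := TR1_cone s.
(* The octahedron on [idm Z = g \oc s] makes the cone of [s] isomorphic to X. *)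
have gsd : dist (g \oc s) (0 : hom Z (zobj T)) 0 by rewrite -gs; exact: TR1_id.
have [u [v [uv _ _ _ _]]] := TR4 sd ((TR2 f g h).1 fgh) gsd.
have WX : tri (zobj T) (shift X) (shift W).
  by apply: (tri_rot _ _ _).1; exists u, v, (shiftm s1 \oc - shiftm f).
have /isomorphic_shift XW := tri_zerol WX (@zobjP T).
apply: (tri_iso (isomorphic_refl Z) (isomorphic_refl Y) (isomorphic_sym XW)).
by exists s, s1, s2.
Qed.

Lemma dist_colift_shift X Y Z W (f : hom X Y) (g : hom Y Z)
    (h : hom Z (shift X)) (s : hom Z W) :
  dist f g h -> hom0 (shift X) W -> s \oc g = 0 -> s = 0.
Proof.
move=> fgh XW0 sg0; have [t ->] := dist_colift ((TR2 f g h).1 fgh) sg0.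
by rewrite (XW0 t) comp0m.
Qed.

(** The composites X -> Z -> Y' and X' -> Z -> Y vanish, which gives comparison maps both ways. The
    conditions on shifted objects leave the identity as the only endomorphism of an outer vertex
    compatible with its map to or from Z, so the comparison maps are inverse to each other. *)
Lemma tri_unique X Y X' Y' Z :
  hom0 X Y' -> hom0 X' Y -> hom0 (shift X) Y -> hom0 (shift X') Y' ->
  tri X Z Y -> tri X' Z Y' -> isomorphic X X' /\ isomorphic Y Y'.
Proof.
move=> XY' X'Y XY X'Y' [f [g [h fgh]]] [f' [g' [h' fgh']]]; split.
  have [a fa] := dist_lift fgh' (XY' (g' \oc f)).
  have [a' fa'] := dist_lift fgh (X'Y (g \oc f')).
  exists a, a'; split; apply/eqP; rewrite -subr_eq0; apply/eqP.
    apply: (dist_lift_shift fgh XY).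
    by rewrite compDr compmN compA -fa' -fa compm1 subrr.
  apply: (dist_lift_shift fgh' X'Y').
  by rewrite compDr compmN compA -fa -fa' compm1 subrr.
have [c gc] := dist_colift fgh (XY' (g' \oc f)).
have [c' gc'] := dist_colift fgh' (X'Y (g \oc f')).
exists c, c'; split; apply/eqP; rewrite -subr_eq0; apply/eqP.
  apply: (dist_colift_shift fgh XY).
  by rewrite compDl compNm -compA -gc -gc' comp1m subrr.
apply: (dist_colift_shift fgh' X'Y').
by rewrite compDl compNm -compA -gc' -gc comp1m subrr.
Qed.

Lemma isomorphic_shiftz X Y n :
  isomorphic (shiftz X n) (shiftz Y n) <-> isomorphic X Y.
Proof.
split=> [XY|]; last exact: shiftz_iso.
have XK := shiftzD X n (- n); have YK := shiftzD Y n (- n).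
rewrite subrr in XK YK.
apply: isomorphic_trans (isomorphic_sym XK) (isomorphic_trans _ YK).
exact: shiftz_iso.
Qed.

(** * Shifts of full subcategories and the calculus of [star] *)

Lemma strictly_full_shift C n : strictly_full (shift_subcat C n).
Proof.
by move=> X Y XY [Z CZ XZ]; exists Z => //;
  exact: isomorphic_trans (isomorphic_sym XY) XZ.
Qed.

Lemma shift_subcatD C m n :
  shift_subcat (shift_subcat C m) n = shift_subcat C (m + n).
Proof.
apply/seteqP; split=> [Z [X [Y CY XY] ZX]|Z [Y CY ZY]].
  exists Y => //; apply: isomorphic_trans ZX _.
  exact: isomorphic_trans (shiftz_iso n XY) (shiftzD _ _ _).
exists (shiftz Y m); first by exists Y => //; exact: isomorphic_refl.
exact: isomorphic_trans ZY (isomorphic_sym (shiftzD _ _ _)).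
Qed.

Lemma shift_subcat0 C : strictly_full C -> shift_subcat C 0 = C.
Proof.
move=> fC; apply/seteqP; split=> [Z [X CX ZX]|Z CZ].
  by apply: fC CX; exact: isomorphic_sym.
by exists Z => //; exact: isomorphic_refl.
Qed.

Lemma shift_subcatS C D n : C `<=` D -> shift_subcat C n `<=` shift_subcat D n.
Proof. by move=> CD Z [X CX ZX]; exists X => //; exact: CD. Qed.

Lemma shift_subcatI C D n : strictly_full C ->
  shift_subcat (C `&` D) n = shift_subcat C n `&` shift_subcat D n.
Proof.
move=> fC; apply/seteqP; split=> [Z [X [CX DX] ZX]|Z [[X CX ZX] [Y DY ZY]]].
  by split; exists X.
exists Y => //; split=> //; apply: fC CX; apply/(isomorphic_shiftz _ _ n).
exact: isomorphic_trans (isomorphic_sym ZX) ZY.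
Qed.

Lemma shift_subcat_le C m n : shift_subcat C 1 `<=` C -> m <= n ->
  shift_subcat C n `<=` shift_subcat C m.
Proof.
move=> C1 mn; rewrite -(subrKC m n) -(gez0_abs (m := n - m)) ?subr_ge0 //.
elim: `|_|%N => [|k IH]; first by rewrite addr0.
apply: subset_trans IH; rewrite intS addrCA -shift_subcatD.
exact: shift_subcatS.
Qed.

Lemma shift_subcat_ge C m n : shift_subcat C (- 1) `<=` C -> m <= n ->
  shift_subcat C m `<=` shift_subcat C n.
Proof.
move=> C1 mn; rewrite -(subKr n m) -(gez0_abs (m := n - m)) ?subr_ge0 //.
elim: `|_|%N => [|k IH]; first by rewrite subr0.
apply: subset_trans IH; rewrite intS opprD addrCA -shift_subcatD.
exact: shift_subcatS.
Qed.

Lemma zero_sub_shift C n :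
  zero_subcat `<=` C -> zero_subcat `<=` shift_subcat C n.
Proof.
move=> C0 Z Z0; exists Z; first exact: C0.
apply: isomorphic_zero => //; apply/is_zeroP/hom0_shiftz.
exact/is_zeroP.
Qed.

Lemma hom_vanish_shift C D n :
  hom_vanish (shift_subcat C n) (shift_subcat D n) <-> hom_vanish C D.
Proof.
split=> CD0 X Y.
  move=> CX DY; apply/(hom0_shiftz _ _ n).
  by apply: CD0; [exists X|exists Y] => //; exact: isomorphic_refl.
move=> [X' CX' XX'] [Y' DY' YY'].
apply: hom0_iso (isomorphic_sym XX') (isomorphic_sym YY') _.
by apply/hom0_shiftz; exact: CD0.
Qed.

Lemma hom_vanishS C C' D D' : C `<=` C' -> D `<=` D' ->
  hom_vanish C' D' -> hom_vanish C D.
Proof. by move=> CC' DD' CD0 X Y /CC' CX /DD'; exact: CD0. Qed.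

Lemma starP C D Z :
  star C D Z <-> exists X Y, [/\ C X, D Y & tri X Z Y].
Proof.
split=> [[X [Y [f [g [h [CX DY fgh]]]]]]|[X [Y [CX DY [f [g [h fgh]]]]]]].
  by exists X, Y; split=> //; exists f, g, h.
by exists X, Y, f, g, h.
Qed.

Lemma strictly_full_star C D : strictly_full (star C D).
Proof.
move=> Z Z' ZZ' /starP[X [Y [CX DY XZY]]]; apply/starP; exists X, Y; split=> //.
by apply: tri_iso XZY => //; exact: isomorphic_refl.
Qed.

Lemma starS C C' D D' : C `<=` C' -> D `<=` D' -> star C D `<=` star C' D'.
Proof.
move=> CC' DD' Z /starP[X [Y [/CC' CX /DD' DY XZY]]].
by apply/starP; exists X, Y.
Qed.

(** Each inclusion is one octahedron, on Z -> Y -> V in the first direction and on U -> X -> Z in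
    the second. *)
Lemma starA C D E : star C (star D E) = star (star C D) E.
Proof.
apply/seteqP; split=> Z /starP[X [Y]].
  case=> CX /starP[U [V [DU EV UYV]]] /tri_rot XZY.
  have [W [ZW XW]] := tri_octahedron XZY ((tri_rot _ _ _).1 UYV).
  (* The octahedron was applied to rotated triangles, so its new vertex is the shift of the object
     W' that should sit between X and U. *)
  have [W' WW'] : exists W', isomorphic W (shift W').
    by exists (unshift W); apply: isomorphic_sym; exact: unshiftK.
  apply/starP; exists W', V; split=> //.
    apply/starP; exists X, U; split=> //; apply/tri_shift.
    by apply: tri_iso XW => //; exact: isomorphic_refl.
  by apply/tri_rot; apply: tri_iso ZW => //; exact: isomorphic_refl.
case=> /starP[U [V [CU DV UXV]]] EY XZY.
have [W [UZ VW]] := tri_octahedron UXV XZY.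
by apply/starP; exists U, W; split=> //; apply/starP; exists V, Y.
Qed.

Lemma shift_star C D n : shift_subcat (star C D) n =
  star (shift_subcat C n) (shift_subcat D n).
Proof.
apply/seteqP; split=> Z.
  case=> E /starP[X [Y [CX DY XEY]]] ZE; apply/starP.
  exists (shiftz X n), (shiftz Y n); split.
  - by exists X => //; exact: isomorphic_refl.
  - by exists Y => //; exact: isomorphic_refl.
  have := (tri_shiftz _ _ _ n).2 XEY; apply: tri_iso; last 2 first.
  - exact: isomorphic_sym.
  - exact: isomorphic_refl.
  exact: isomorphic_refl.
case/starP=> X' [Y' [[X CX XX'] [Y DY YY'] XZY]].
have ZE : isomorphic Z (shiftz (shiftz Z (- n)) n).
  by have := isomorphic_sym (shiftzD Z (- n) n); rewrite addNr.
exists (shiftz Z (- n)) => //; apply/starP; exists X, Y; split=> //.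
by apply/(tri_shiftz _ _ _ n); exact: tri_iso XZY.
Qed.

Lemma star_swap C D :
  hom_vanish D (shift_subcat C 1) -> star C D `<=` star D C.
Proof.
move=> DC0 Z /starP[X [Y [CX DY XZY]]]; apply/starP; exists Y, X; split=> //.
apply: tri_swap XZY; apply: DC0 => //.
by exists X => //; exact: isomorphic_refl.
Qed.

Lemma sub_starl C D : zero_subcat `<=` D -> C `<=` star C D.
Proof.
move=> D0 X CX; apply/starP; exists X, (zobj T); split=> //.
  exact/D0/(@zobjP T).
exact/zeror_tri/(@zobjP T).
Qed.

Lemma sub_starr C D : zero_subcat `<=` C -> D `<=` star C D.
Proof.
move=> C0 Y DY; apply/starP; exists (zobj T), Y; split=> //.
  exact/C0/(@zobjP T).
exact/zerol_tri/(@zobjP T).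
Qed.

Lemma hom_vanish_starl C D E :
  hom_vanish C E -> hom_vanish D E -> hom_vanish (star C D) E.
Proof.
move=> CE0 DE0 Z W /starP[X [Y [CX DY XZY]]] EW.
by apply: tri_hom0_from XZY _ _; [exact: CE0|exact: DE0].
Qed.

Lemma hom_vanish_starr C D E :
  hom_vanish E C -> hom_vanish E D -> hom_vanish E (star C D).
Proof.
move=> CE0 DE0 W Z EW /starP[X [Y [CX DY XZY]]].
by apply: tri_hom0_to XZY _ _; [exact: CE0|exact: DE0].
Qed.

(** Since Hom(C, D) = 0 and C[1] lies in C, two triangles over Z with outer terms in C and D have
    isomorphic outer terms. Membership in the smaller classes thus passes to the given X and Y. *)
Lemma star_unique C D C' D' X Y Z :
  strictly_full C' -> strictly_full D' ->
  hom_vanish C D -> shift_subcat C 1 `<=` C -> C' `<=` C -> D' `<=` D ->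
  C X -> D Y -> tri X Z Y -> star C' D' Z -> C' X /\ D' Y.
Proof.
move=> fC' fD' CD0 C1 C'C D'D CX DY XZY /starP[X' [Y' [CX' DY' XZY']]].
have Cs W : C W -> C (shift W).
  by move=> CW; apply: C1; exists W => //; exact: isomorphic_refl.
have [||||XX' YY'] := tri_unique _ _ _ _ XZY XZY'.
- by apply: CD0 => //; exact: D'D.
- by apply: CD0 => //; exact: C'C.
- by apply: CD0 => //; exact: Cs.
- by apply: CD0; [exact/Cs/C'C|exact: D'D].
by split; [apply: fC' CX'|apply: fD' DY']; exact: isomorphic_sym.
Qed.

Lemma star_setI C D C1 D1 C2 D2 :
  strictly_full C2 -> strictly_full D2 ->
  hom_vanish C D -> shift_subcat C 1 `<=` C ->
  C1 `<=` C -> D1 `<=` D -> C2 `<=` C -> D2 `<=` D ->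
  star C1 D1 `&` star C2 D2 = star (C1 `&` C2) (D1 `&` D2).
Proof.
move=> fC2 fD2 CD0 Cs C1C D1D C2C D2D; apply/seteqP; split=> Z.
  case=> /starP[X [Y [CX DY XZY]]] Z2; apply/starP; exists X, Y.
  have [] := star_unique fC2 fD2 CD0 Cs C2C D2D (C1C _ CX) (D1D _ DY) XZY Z2.
  by split.
move=> Z12; split; apply: starS Z12; try exact: subIsetl; exact: subIsetr.
Qed.

(** For Z orthogonal to C, the map X -> Z of its triangle is 0. As Hom(X[1], Y) = 0, composing with
    it is injective on endomorphisms of X, so X = 0 and Z is isomorphic to Y. *)
Lemma right_orth_star C D : strictly_full D -> hom_vanish C D ->
  shift_subcat C 1 `<=` C -> star C D = setT -> right_orth setT C = D.
Proof.
move=> fD CD0 C1 CDT; apply/seteqP; split=> [Z [_ CZ0]|Z DZ]; last first.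
  by split=> // X CX; exact: CD0.
have /starP[X [Y [CX DY XZY]]] : star C D Z by rewrite CDT.
have [f [g [h fgh]]] := XZY.
apply: fD (DY); apply: isomorphic_sym; apply: tri_zerol (XZY) _.
apply/is_zeroP => s; apply: (dist_lift_shift fgh).
  by apply: CD0 => //; apply: C1; exists X => //; exact: isomorphic_refl.
by rewrite (CZ0 _ CX f) comp0m.
Qed.

Lemma triangulated_subcat_shift D n :
  triangulated_subcat D -> shift_subcat D n = D.
Proof.
case=> fD _ Ds Du _.
have Dn X m : D X -> D (shiftz X m).
  by move=> DX; case: m => m; elim: m => [|m IH] //=;
    [apply: Ds|apply: Du|apply: Du].
apply/seteqP; split=> [Z [X DX ZX]|Z DZ].
  by apply: fD (isomorphic_sym ZX) _; exact: Dn.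
exists (shiftz Z (- n)); first exact: Dn.
by have := isomorphic_sym (shiftzD Z (- n) n); rewrite addNr.
Qed.

(** * A t-structure on a triangulated subcategory: orthogonal, truncations and heart *)

Section TStructure.
Context {D C : set T} (hD : triangulated_subcat D) (hC : t_structure D C).
Let N := right_orth D C.

Lemma strictly_full_right_orth : strictly_full N.
Proof.
move=> Y Y' YY' [DY CY0]; case: hD => fD _ _ _ _; split; first exact: fD DY.
by move=> X CX; apply: hom0_iso (isomorphic_refl X) YY' _; exact: CY0.
Qed.

Lemma right_orth_sub : N `<=` D. Proof. by move=> Y []. Qed.

Lemma hom_vanish_right_orth : hom_vanish C N.
Proof. by move=> X Y CX [_ CY0]; exact: CY0. Qed.

(** Hom(C, N[-1]) = Hom(C[1], N), and C[1] is contained in C. *)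
Lemma right_orth_unshift : shift_subcat N (- 1) `<=` N.
Proof.
move=> Z NZ; split.
  by rewrite -(triangulated_subcat_shift (- 1) hD); apply: shift_subcatS NZ;
    exact: right_orth_sub.
move=> X CX; case: hC => _ _ C1 _.
suff CN0 : hom_vanish C (shift_subcat N (- 1)) by exact: CN0.
apply/(hom_vanish_shift _ _ 1); rewrite shift_subcatD addNr.
rewrite shift_subcat0; last exact: strictly_full_right_orth.
exact: hom_vanishS C1 (@subset_refl _ _) hom_vanish_right_orth.
Qed.

Lemma t_structure_star : D `<=` star C N.
Proof.
case: hC => _ _ _ dec E /dec [A [B [f [g [h [CA NB fgh]]]]]].
by exists A, B, f, g, h.
Qed.

Lemma zero_sub_right_orth : zero_subcat `<=` N.
Proof.
case: hD => _ D0 _ _ _ Z Z0; split; first exact: D0.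
by move=> X _; exact: (Z0 X).2.
Qed.

(** Truncating a zero object by A -> Z -> B makes B isomorphic to A[1], hence an object of both C
    and its orthogonal. So B is a zero object in C, and C is closed under isomorphism. *)
Lemma zero_sub_t_structure : zero_subcat `<=` C.
Proof.
move=> Z Z0; case: hD => _ D0 _ _ _; case: (hC) => _ fC C1 _.
have /starP[A [B [CA NB /tri_rot AZB]]] := t_structure_star (D0 _ Z0).
have BA := tri_zerol AZB Z0.
have CB : C B by apply: C1; exists A.
apply: fC (CB); apply: isomorphic_zero => //.
by apply/is_zeroP => t; exact: (hom_vanish_right_orth CB NB).
Qed.

Lemma strictly_full_heart : strictly_full (heart D C).
Proof.
by move=> X Y XY [Xge Xle]; split;
  [exact: strictly_full_shift XY Xge|exact: strictly_full_shift XY Xle].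
Qed.

Lemma zero_sub_heart : zero_subcat `<=` heart D C.
Proof.
move=> X X0; split; apply: zero_sub_shift X0.
  exact: zero_sub_right_orth.
exact: zero_sub_t_structure.
Qed.

Lemma tle_mono i j : i <= j -> tle C i `<=` tle C j.
Proof.
by case: hC => _ _ C1 _ ij; apply: shift_subcat_le; rewrite ?lerN2.
Qed.

Lemma tge_anti i j : i <= j -> tge D C j `<=` tge D C i.
Proof.
move=> ij; apply: shift_subcat_ge; first exact: right_orth_unshift.
by rewrite lerD2r lerN2.
Qed.

Lemma tle_sub i : tle C i `<=` D.
Proof.
case: hC => CD _ _ _.
rewrite -[X in _ `<=` X](triangulated_subcat_shift (- i) hD).
exact: shift_subcatS.
Qed.

Lemma tge_sub j : tge D C j `<=` D.
Proof.
rewrite -[X in _ `<=` X](triangulated_subcat_shift (- j + 1) hD).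
exact/shift_subcatS/right_orth_sub.
Qed.

Lemma heart_sub : heart D C `<=` D.
Proof. by move=> X [_ /tle_sub]. Qed.

End TStructure.

(** * Intersections of [star] classes, and degrees of nonzero maps *)

Lemma bigcap_star (K : Type) (i0 : K) C D (F G : K -> set T) :
  hom_vanish C D -> shift_subcat C 1 `<=` C ->
  (forall i, strictly_full (F i)) -> (forall i, strictly_full (G i)) ->
  (forall i, F i `<=` C) -> (forall i, G i `<=` D) ->
  \bigcap_i star (F i) (G i) = star (\bigcap_i F i) (\bigcap_i G i).
Proof.
move=> CD0 C1 fF fG FC GD; apply/seteqP; split=> Z.
  (* The index [i0] supplies one triangle; by uniqueness its outer terms lie in F i and G i for
     every i. *)
  move=> FGZ; have /starP[X [Y [FX GY XZY]]] := FGZ i0 I.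
  have FG i : F i X /\ G i Y.
    exact: (star_unique (fF i) (fG i) CD0 C1 (FC i) (GD i) (FC _ _ FX)
      (GD _ _ GY) XZY (FGZ i I)).
  by apply/starP; exists X, Y; split=> // i _; case: (FG i).
by move=> FGZ i _; apply: starS FGZ; exact: bigcap_inf.
Qed.

Lemma star_zero : star zero_subcat zero_subcat = zero_subcat :> set T.
Proof.
apply/seteqP; split=> [Z /starP[X [Y [X0 Y0 XZY]]]|]; last first.
  exact: sub_starl.
by apply: is_zero_iso Y0; exact/isomorphic_sym/(tri_zerol XZY).
Qed.

Lemma hom_degreesP C D n :
  hom_degrees C D n <-> ~ hom_vanish C (shift_subcat D n).
Proof.
split=> [[X [Y [f [CX DY f0]]]] CD0|].
  by apply: f0; apply: CD0 => //; exists Y => //; exact: isomorphic_refl.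
apply: contra_notP => nCD X Z CX [Y DY ZY].
apply: hom0_iso (isomorphic_refl X) (isomorphic_sym ZY) _ => f.
by apply: contrapT => f0; apply: nCD; exists X, Y, f.
Qed.

(** If degree 0 did not occur, all endomorphisms of objects of C would vanish, and C would contain
    only zero objects. *)
Lemma hom_degrees_nonzero C :
  zero_subcat `<=` C -> strictly_full C -> C <> zero_subcat ->
  hom_degrees C C 0.
Proof.
move=> C0 fC nC; apply/hom_degreesP; rewrite shift_subcat0 // => CC0.
apply: nC; apply/seteqP; split=> // X CX.
by apply/is_zeroP; exact: CC0.
Qed.

Lemma hom_vanish_star C D C' D' :
  zero_subcat `<=` C -> zero_subcat `<=` D ->
  zero_subcat `<=` C' -> zero_subcat `<=` D' ->
  hom_vanish (star C D) (star C' D') <->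
  [/\ hom_vanish C C', hom_vanish C D', hom_vanish D C' & hom_vanish D D'].
Proof.
move=> C0 D0 C'0 D'0; split=> [V|[CC' CD' DC' DD']].
  by split; apply: hom_vanishS V; (exact: sub_starl || exact: sub_starr).
by apply: hom_vanish_starl; apply: hom_vanish_starr.
Qed.

(** * Gluing the two t-structures along the semiorthogonal decomposition *)

Section Gluing.
Context {T1 T2 P1 P2 : set T} (hT : semiorthogonal_decomposition T1 T2).
Context (ht1 : t_structure T1 P1) (ht2 : t_structure T2 P2).
Context (hcomp : t_compatible P1 T2 P2).
Let hT1 : triangulated_subcat T1. Proof. by case: hT. Qed.
Let hT2 : triangulated_subcat T2. Proof. by case: hT. Qed.
Let T21 : hom_vanish T2 T1. Proof. by case: hT. Qed.
Let T2s : shift_subcat T2 1 `<=` T2.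
Proof. by rewrite triangulated_subcat_shift. Qed.
Let N1 := right_orth T1 P1.
Let N2 := right_orth T2 P2.
Let Le := star P2 (shift_subcat P1 1).
Let Ge := star N2 (shift_subcat N1 1).

Lemma glued_hom_vanish : hom_vanish Le Ge.
Proof.
have [P1T _ P1s _] := ht1; have [P2T _ _ _] := ht2.
(* In order: orthogonality in T2; semiorthogonality, as N1[1] lies in T1; compatibility, as P1[1]
   lies in P1; orthogonality in T1, shifted by one. *)
apply: hom_vanish_starl; apply: hom_vanish_starr.
- exact: hom_vanish_right_orth.
- apply: hom_vanishS P2T _ T21; rewrite -(triangulated_subcat_shift 1 hT1).
  exact/shift_subcatS/right_orth_sub.
- exact: hom_vanishS P1s (@subset_refl _ _) hcomp.
- exact/hom_vanish_shift/hom_vanish_right_orth.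
Qed.

Lemma glued_star : star Le Ge = setT.
Proof.
apply/seteqP; split=> // Z _.
have : star T2 T1 Z by case: hT => _ _ _ ->.
rewrite -[T1](triangulated_subcat_shift 1 hT1).
move=> /(starS (t_structure_star ht2)
          (shift_subcatS (n := 1) (t_structure_star ht1))).
(* Reassociation isolates N2 * P1[1] between the outer factors P2 and N1[1]; the vanishing needed to
   swap it is compatibility shifted by one. *)
rewrite shift_star /Le /Ge -!starA; apply: starS => //.
rewrite !starA; apply: starS => //; apply: star_swap.
exact/hom_vanish_shift.
Qed.

Lemma glued_shift : shift_subcat Le 1 `<=` Le.
Proof.
case: ht1 ht2 => [_ _ P1s _] [_ _ P2s _].
by rewrite shift_star; apply: starS => //; exact: shift_subcatS.
Qed.

Lemma glued_right_orth : right_orth setT Le = Ge.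
Proof.
apply: right_orth_star; [exact: strictly_full_star|exact: glued_hom_vanish|
  exact: glued_shift|exact: glued_star].
Qed.

Lemma glued_t_structure : t_structure setT Le.
Proof.
split=> //; [exact: strictly_full_star|exact: glued_shift|move=> E _].
have [X [Y [f [g [h [LX GY fgh]]]]]] : star Le Ge E by rewrite glued_star.
by exists X, Y, f, g, h; rewrite glued_right_orth.
Qed.

Lemma glued_tle i : tle Le i = star (tle P2 i) (shift_subcat (tle P1 i) 1).
Proof. by rewrite /tle shift_star !shift_subcatD addrC. Qed.

Lemma glued_tge j :
  tge setT Le j = star (tge T2 P2 j) (shift_subcat (tge T1 P1 j) 1).
Proof.
by rewrite /tge glued_right_orth shift_star !shift_subcatD [1 + _]addrC.
Qed.

Lemma glued_bounded :
  t_bounded T1 P1 -> t_bounded T2 P2 -> t_bounded setT Le.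
Proof.
move=> b1 b2; apply/seteqP; split=> // E _.
(* Using T1[1] for T1 presents the second vertex as Y'[1], so the bounds on Y' match the shifted
   factor of the glued classes. *)
have : star T2 (shift_subcat T1 1) E.
  by rewrite triangulated_subcat_shift //; case: hT => _ _ _ ->.
case/starP=> X [Y [T2X [Y' T1Y' YY'] XEY]].
move: T2X T1Y'; rewrite b1 b2 => -[i2 _ [j2 _ [Xi Xj]]] [i1 _ [j1 _ [Yi Yj]]].
exists (Order.max i1 i2) => //; exists (Order.min j1 j2) => //.
rewrite glued_tle glued_tge; split; apply/starP; exists X, Y; split=> //.
- by apply: (tle_mono ht2) Xi; rewrite le_max lexx orbT.
- by exists Y' => //; apply: (tle_mono ht1) Yi; rewrite le_max lexx.
- by apply: (tge_anti hT2 ht2) Xj; rewrite ge_min lexx orbT.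
- by exists Y' => //; apply: (tge_anti hT1 ht1) Yj; rewrite ge_min lexx.
Qed.

Let shiftT1 C : C `<=` T1 -> shift_subcat C 1 `<=` T1.
Proof.
by move=> CT1; rewrite -(triangulated_subcat_shift 1 hT1); exact: shift_subcatS.
Qed.

Lemma glued_nondegenerate :
  t_nondegenerate T1 P1 -> t_nondegenerate T2 P2 -> t_nondegenerate setT Le.
Proof.
move=> [l1 g1] [l2 g2]; split.
  under eq_bigcapr do rewrite glued_tle.
  rewrite (bigcap_star 0 T21 T2s); last 4 first.
  - by move=> i; exact: strictly_full_shift.
  - by move=> i; exact: strictly_full_shift.
  - by move=> i; exact: tle_sub.
  - by move=> i; exact/shiftT1/tle_sub.
  (* Shifting by 1 turns [tle P1 i] into [tle P1 (i - 1)]: the family is only reindexed, and its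
     intersection is unchanged. *)
  rewrite l2 -[RHS]star_zero -[X in _ = star _ X]l1; congr (star _ _).
  apply/seteqP; split=> X XP i _.
    have := XP (i + 1) I.
    by rewrite /tle shift_subcatD opprD -addrA addNr addr0.
  have := XP (i - 1) I.
  by rewrite /tle shift_subcatD opprB addrC.
under eq_bigcapr do rewrite glued_tge.
rewrite (bigcap_star 0 T21 T2s); last 4 first.
- by move=> i; exact: strictly_full_shift.
- by move=> i; exact: strictly_full_shift.
- by move=> i; exact: tge_sub.
- by move=> i; exact/shiftT1/tge_sub.
rewrite g2 -[RHS]star_zero -[X in _ = star _ X]g1; congr (star _ _).
apply/seteqP; split=> X XP i _.
  have := XP (i + 1) I.
  by rewrite /tge shift_subcatD opprD addrNK.
have := XP (i - 1) I.
by rewrite /tge shift_subcatD opprB [1 - i]addrC.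
Qed.

Lemma glued_heart :
  heart setT Le = star (heart T2 P2) (shift_subcat (heart T1 P1) 1).
Proof.
rewrite /heart glued_tle glued_tge.
rewrite shift_subcatI; last exact: strictly_full_shift.
apply: (star_setI _ _ T21 T2s); try exact: strictly_full_shift.
- exact: tge_sub.
- exact/shiftT1/tge_sub.
- exact: tle_sub.
- exact/shiftT1/tle_sub.
Qed.

(** Of the four Homs from A2 * A1[1] to its shift by n, Hom(A2, A1[n + 1]) is 0 by
    semiorthogonality, two are those of A1 and of A2 in degree n, and Hom(A1[1], A2[n]) is Hom(A1,
    A2[n - 1]), whence the offset. *)
Lemma glued_hom_degrees :
  hom_degrees (heart setT Le) (heart setT Le) =
  hom_degrees (heart T1 P1) (heart T1 P1) `|`
  hom_degrees (heart T2 P2) (heart T2 P2) `|`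
  [set n + 1 | n in hom_degrees (heart T1 P1) (heart T2 P2)].
Proof.
have A10 := zero_sub_heart hT1 ht1; have A20 := zero_sub_heart hT2 ht2.
have A1T := heart_sub hT1 ht1; have A2T := heart_sub hT2 ht2.
rewrite glued_heart; set A1 := heart T1 P1; set A2 := heart T2 P2.
have shiftE n : hom_vanish (star A2 (shift_subcat A1 1))
    (shift_subcat (star A2 (shift_subcat A1 1)) n) <->
  [/\ hom_vanish A1 (shift_subcat A1 n), hom_vanish A2 (shift_subcat A2 n)
    & hom_vanish A1 (shift_subcat A2 (n - 1))].
  rewrite shift_star hom_vanish_star; try exact: zero_sub_shift;
    [|exact: A20|exact/zero_sub_shift/zero_sub_shift].
  have e1 := hom_vanish_shift A1 (shift_subcat A1 n) 1.
  rewrite shift_subcatD addrC -shift_subcatD in e1.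
  have e12 := hom_vanish_shift A1 (shift_subcat A2 (n - 1)) 1.
  rewrite shift_subcatD subrK in e12.
  split=> [[v2 _ /e12 v12 /e1 v1]//|[/e1 v1 v2 /e12 v12]]; split=> //.
  apply: hom_vanishS A2T _ T21.
  by rewrite -(triangulated_subcat_shift n hT1); exact/shift_subcatS/shiftT1.
apply/seteqP; split=> n.
  move=> /hom_degreesP; rewrite shiftE => nv.
  apply: contrapT => nd; apply: nv; split; apply: contrapT => /hom_degreesP dn;
    apply: nd.
  - by left; left.
  - by left; right.
  - by right; exists (n - 1) => //; rewrite subrK.
move=> dn; apply/hom_degreesP; rewrite shiftE => -[v1 v2 v12].
case: dn => [[|]|[m]]; try by move/hom_degreesP.
by move=> /hom_degreesP + mn; apply; rewrite -(addrK 1 m) mn.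
Qed.

End Gluing.

End TriangulatedTheory.

(** * Suprema of sets of integers in the extended integers *)

Section Supremum.
Implicit Types (S X Y R : set int) (y : \bar int).

(** On a nonempty set [supremum] chooses an element of [supremums], so a least upper bound must
    first be exhibited: the maximum if S is bounded above, [+oo] otherwise. *)
Lemma supremums_int_neq0 S : S !=set0 -> supremums (EFin @` S) !=set0.
Proof.
case=> n0 Sn0; have [[M SM]|noM] := pselect (exists M, forall n, S n -> n <= M).
  (* Elements below [n0] do not affect the supremum. The others are [n0 + k] with k a natural number
     at most |M - n0|, so a greatest k exists. *)
  pose P k := `[< S (n0 + Posz k) >].
  have exP : exists k, P k by exists 0%N; apply/asboolP; rewrite addr0.
  have ubP k : P k -> (k <= `|M - n0|)%N.
    move=> /asboolP/SM; rewrite -lerBrDl => kM.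
    by rewrite -lez_nat gez0_abs // (le_trans _ kM).
  have [k /asboolP Sk kmax] := ex_maxnP exP ubP.
  exists (n0 + Posz k)%:E; split=> [_ [n Sn <-]|y]; last first.
    by apply; exists (n0 + Posz k).
  rewrite lee_fin; have [nn0|n0n] := leP n n0.
    by rewrite (le_trans nn0)// lerDl.
  have nE : n = n0 + `|n - n0|%N%:Z by rewrite gez0_abs ?subr_ge0 ?ltW// subrKC.
  by rewrite nE lerD2l lez_nat kmax//; apply/asboolP; rewrite -nE.
exists +oo%E; split=> [? _|[r|//|] Sr]; first exact: leey.
  by case: noM; exists r => n Sn; rewrite -lee_fin; apply: Sr; exists n.
by have := Sr n0%:E; rewrite leeNy_eq; apply; exists n0.
Qed.

Lemma supremum_intP x0 S y : S !=set0 ->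
  (supremum x0 (EFin @` S) <= y)%E <-> forall n, S n -> (n%:E <= y)%E.
Proof.
move=> S0; have [ub lub] : supremums (EFin @` S) (supremum x0 (EFin @` S)).
  have [n Sn] := S0.
  rewrite /supremum ifF; last by apply/negbTE/set0P; exists n%:E, n.
  exact: xgetPex (supremums_int_neq0 S0).
split=> [Sy n Sn|Sy]; first by apply: le_trans Sy; apply: ub; exists n.
by apply: lub => _ [n Sn <-]; exact: Sy.
Qed.

Lemma supremumNy_intP S y :
  (supremum -oo%E (EFin @` S) <= y)%E <-> forall n, S n -> (n%:E <= y)%E.
Proof.
have [->|/set0P] := eqVneq S set0; last exact: supremum_intP.
by rewrite image_set0 supremum0 leNye.
Qed.

(** For empty S the default -1 becomes 0 after adding 1, which is where 0 <= y enters. *)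
Lemma supremumN1_intP S y : (0 <= y)%E ->
  (supremum (-1)%:E (EFin @` S) + 1%:E <= y)%E <->
  forall n, S n -> ((n + 1)%:E <= y)%E.
Proof.
move=> y0; have [->|/set0P S0] := eqVneq S set0.
  by rewrite image_set0 supremum0 -EFinD addNr y0.
rewrite -leeBrDr // supremum_intP //.
by split=> Sy n /Sy; rewrite leeBrDr.
Qed.

(** Having 0 in X or Y makes both sides at least 0, so it suffices that they have the same upper
    bounds y >= 0. For such y the last term, which is 0 when R is empty, then imposes no
    condition. *)
Lemma supremum_int_max X Y R : X 0 \/ Y 0 ->
  supremum -oo%E (EFin @` (X `|` Y `|` [set n + 1 | n in R])) =
  Order.max
    (Order.max (supremum -oo%E (EFin @` X)) (supremum -oo%E (EFin @` Y)))
    (supremum (-1)%:E (EFin @` R) + 1%:E)%E.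
Proof.
move=> XY0; set l := LHS; set r := RHS.
have supP y : (0 <= y)%E -> (l <= y)%E <-> (r <= y)%E.
  move=> y0; rewrite supremumNy_intP !ge_max -!andbA; split.
    move=> Zy; apply/and3P; split.
    - by apply/supremumNy_intP => n Xn; apply: Zy; left; left.
    - by apply/supremumNy_intP => n Yn; apply: Zy; left; right.
    - by apply/supremumN1_intP => // n Rn; apply: Zy; right; exists n.
  case/and3P=> /supremumNy_intP Xy /supremumNy_intP Yy.
  move=> /(supremumN1_intP _ y0) Ry n.
  by move=> [[/Xy//|/Yy//]|[m Rm <-]]; exact: Ry.
have l0 : (0 <= l)%E.
  by apply: (supremumNy_intP _ _).1 (lexx l) _ _; left.
have r0 : (0 <= r)%E.
  by rewrite !le_max -orbA; case: XY0 => /((supremumNy_intP _ _).1 (lexx _)) ->;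
    rewrite ?orbT.
by apply/le_anti/andP; split; [apply/supP|apply/supP].
Qed.
End Supremum.

Theorem theorem2p7 (T : triangulatedCat) (T1 T2 : set T)
    (hT : semiorthogonal_decomposition T1 T2)
    (T1le0 T2le0 : set T)
    (ht1 : t_structure T1 T1le0) (ht2 : t_structure T2 T2le0)
    (hcomp : t_compatible T1le0 T2 T2le0) :
  let Tle0 : set T := star T2le0 (shift_subcat T1le0 1) in
  let A1 := heart T1 T1le0 in
  let A2 := heart T2 T2le0 in
  let A := heart setT Tle0 in
  [/\ t_structure setT Tle0,
      (t_bounded T1 T1le0 -> t_bounded T2 T2le0 -> t_bounded setT Tle0),
      (t_nondegenerate T1 T1le0 -> t_nondegenerate T2 T2le0 ->
       t_nondegenerate setT Tle0),
      A = star A2 (shift_subcat A1 1)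
    & (A1 <> zero_subcat \/ A2 <> zero_subcat ->
       dim_heart A =
       Order.max (Order.max (dim_heart A1) (dim_heart A2))
         (rdim A1 A2 + 1%:E)%E)].
Proof.
move=> Tle0 A1 A2 A; have [hT1 hT2 _ _] := hT; split.
- exact: (glued_t_structure hT ht1 ht2 hcomp).
- exact: (glued_bounded hT ht1 ht2 hcomp).
- exact: (glued_nondegenerate hT ht1 ht2 hcomp).
- exact: (glued_heart hT ht1 ht2 hcomp).
move=> nz; rewrite /dim_heart /rdim (glued_hom_degrees hT ht1 ht2 hcomp).
apply: supremum_int_max.
by case: nz => nz; [left|right]; apply: hom_degrees_nonzero nz;
  try exact: strictly_full_heart; exact: zero_sub_heart.
Qed.
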